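(* Let $E$ be a truncated vector lattice, $\bar{E}$ its set of fixed points, and $E\oplus\mathbb{R}$ its Alexandroff unitization. Then $E\oplus\mathbb{R}$ is Dedekind complete if and only if $E$ is Dedekind complete and the following property holds: $(\ast)$ every nonempty subset of $\bar{E}$ that is order bounded in $E\oplus\mathbb{R}$ has a supremum in $E\oplus\mathbb{R}$.
   Context: A truncation on a (real) Riesz space (vector lattice) $E$ is a map $x\mapsto\bar{x}$ from $E^{+}$ to $E^{+}$ such that for all $a,b\in E^{+}$: $(\tau_1)$ $a\wedge\bar{b}\leq\bar{a}\leq a$; $(\tau_2)$ $\bar{a}=0$ implies $a=0$. A truncated vector lattice (truncated Riesz space) is a Riesz space $E$ equipped with a truncation. The set of fixed points is $\bar{E}=\{x\in E:\overline{|x|}=|x|\}$. The (Alexandroff) unitization $E\oplus\mathbb{R}=\{x+\lambda: x\in E,\lambda\in\mathbb{R}\}$ is the vector space $E\times\mathbb{R}$ (with $E$ identified with $E\times\{0\}$ and $\mathbb{R}$ with $\{0\}\times\mathbb{R}$, so $1=(0,1)$), ordered by the positive cone $(E\oplus\mathbb{R})^{+}=E^{+}\cup\{x+\lambda: x\in E,\ \lambda\in\mathbb{R},\ \lambda>0,\ \tfrac{1}{\lambda}x^{-}\in\bar{E}\}$. It is known that $E\oplus\mathbb{R}$ is a Riesz space, that $E$ is a vector sublattice (indeed a maximal ideal) of it, that $\bar{x}=x\wedge 1$ for all $x\in E^{+}$, and that $\bar{E}=\{x\in E:|x|\leq 1\text{ in }E\oplus\mathbb{R}\}$ (so every subset of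 $\bar{E}$ is order bounded in $E\oplus\mathbb{R}$). A Riesz space is Dedekind complete if every nonempty subset that is bounded above has a supremum. *)

(* Defs.v *)
From HB Require Import structures.
From mathcomp Require Import all_boot all_order all_algebra.
From mathcomp Require Import boolp classical_sets reals.

Set Implicit Arguments.
Unset Strict Implicit.
Unset Printing Implicit Defensive.

Import Order.TTheory GRing.Theory Num.Theory.

Local Open Scope classical_set_scope.
Local Open Scope ring_scope.

(* The lattice operations are fields of this mixin, characterized by their     *)
(* universal properties, because Hierarchy Builder rejects a structure joining *)
(* [Order.Lattice] with [GRing.Lmodule] downstream of [Num.RealDomain].        *)
HB.mixin Record POrderedZmodule_isRiesz (R : realType) E
    of GRing.Lmodule R E & Num.POrderedZmodule E := {
  riesz_join : E -> E -> E;
  riesz_meet : E -> E -> E;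
  riesz_leUx : forall x y z : E, (riesz_join x y <= z) = (x <= z) && (y <= z);
  riesz_lexI : forall x y z : E, (x <= riesz_meet y z) = (x <= y) && (x <= z);
  riesz_leD2r : forall z x y : E, x <= y -> x + z <= y + z;
  riesz_scale_ge0 : forall (a : R) (x : E), 0 <= a -> 0 <= x -> 0 <= a *: x
}.

#[short(type="rieszType")]
HB.structure Definition Riesz (R : realType) :=
  { E of POrderedZmodule_isRiesz R E & GRing.Lmodule R E
       & Num.POrderedZmodule E }.

Definition riesz_neg (R : realType) (E : rieszType R) (x : E) : E :=
  riesz_join (- x) 0.
Definition riesz_abs (R : realType) (E : rieszType R) (x : E) : E :=
  riesz_join x (- x).

Definition dedekind_complete (R : realType) (E : rieszType R) : Prop :=
  forall A : set E, A !=set0 -> has_ubound A -> supremums A !=set0.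

Definition order_bounded (R : realType) (E : rieszType R) (A : set E) : Prop :=
  has_lbound A /\ has_ubound A.

(* A truncation is a map of the positive cone; it is represented by a total    *)
(* function [trunc] whose values outside the positive cone are arbitrary.      *)
HB.mixin Record Riesz_isTruncated (R : realType) E of Riesz R E := {
  trunc : E -> E;
  trunc_ge0 : forall a : E, 0 <= a -> 0 <= trunc a;
  trunc_meet_le : forall a b : E, 0 <= a -> 0 <= b ->
    riesz_meet a (trunc b) <= trunc a;
  trunc_le : forall a : E, 0 <= a -> trunc a <= a;
  trunc_eq0 : forall a : E, 0 <= a -> trunc a = 0 -> a = 0
}.

#[short(type="truncRieszType")]
HB.structure Definition TruncatedRiesz (R : realType) :=
  { E of Riesz_isTruncated R E & Riesz R E }.

Definition fixed_points (R : realType) (E : truncRieszType R) : set E :=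
  [set x | trunc (riesz_abs x) = riesz_abs x].
Arguments fixed_points {R} E.

(* An alias of [E * R], to which the order of the unitization is attached;     *)
(* [(x, l)] stands for x + l.                                                  *)
Definition unitization (R : realType) (E : truncRieszType R) : Type :=
  (E * R^o)%type.

HB.instance Definition _ (R : realType) (E : truncRieszType R) :=
  GRing.Lmodule.copy (unitization E) (E * R^o)%type.

Definition unit_in (R : realType) (E : truncRieszType R) (x : E) :
  unitization E := (x, 0).

Definition unit_one (R : realType) (E : truncRieszType R) : unitization E :=
  (0, 1).
Arguments unit_one {R} E.

Definition unit_cone (R : realType) (E : truncRieszType R) :
    set (unitization E) :=
  [set unit_in x | x in [set x : E | 0 <= x]] `|`
  [set z | 0 < z.2 /\ fixed_points E (z.2^-1 *: riesz_neg z.1)].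

Definition unit_le (R : realType) (E : truncRieszType R)
  (p q : unitization E) : bool := `[< unit_cone (q - p) >].

Section RieszTheory.
Context {R : realType} {E : rieszType R}.
Implicit Types (x y z : E) (a b : R).

Lemma rz_leUl x y : x <= riesz_join x y.
Proof. by have := lexx (riesz_join x y); rewrite riesz_leUx => /andP[]. Qed.

Lemma rz_leUr x y : y <= riesz_join x y.
Proof. by have := lexx (riesz_join x y); rewrite riesz_leUx => /andP[]. Qed.

Lemma rz_joinC x y : riesz_join x y = riesz_join y x.
Proof. by apply/le_anti; rewrite !riesz_leUx !rz_leUl !rz_leUr. Qed.

Lemma rz_lexU x y z : x <= y -> x <= riesz_join y z.
Proof. by move=> xy; apply: le_trans (rz_leUl _ _). Qed.

Lemma rz_leIl x y : riesz_meet x y <= x.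
Proof. by have := lexx (riesz_meet x y); rewrite riesz_lexI => /andP[]. Qed.

Lemma rz_leIr x y : riesz_meet x y <= y.
Proof. by have := lexx (riesz_meet x y); rewrite riesz_lexI => /andP[]. Qed.

Lemma rz_meetxx x : riesz_meet x x = x.
Proof. by apply/le_anti; rewrite rz_leIl riesz_lexI lexx. Qed.

Lemma rz_leD x y z t : x <= y -> z <= t -> x + z <= y + t.
Proof.
move=> xy zt; apply: (le_trans (riesz_leD2r z _ _ xy)).
by rewrite ![y + _]addrC; exact: riesz_leD2r.
Qed.

Lemma rz_leBl x y z : (x - z <= y) = (x <= y + z).
Proof.
apply/idP/idP => [/(riesz_leD2r z)|/(riesz_leD2r (- z))].
  by rewrite subrK.
by rewrite addrK.
Qed.

Lemma rz_subr_ge0 x y : (0 <= y - x) = (x <= y).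
Proof.
apply/idP/idP => [/(riesz_leD2r x)|/(riesz_leD2r (- x))].
  by rewrite add0r subrK.
by rewrite subrr.
Qed.

Lemma rz_oppr_le0 x : (- x <= 0) = (0 <= x).
Proof. by rewrite -[- x]add0r rz_leBl add0r. Qed.

Lemma rz_leN2 x y : (- x <= - y) = (y <= x).
Proof. by rewrite -(rz_subr_ge0 (- x)) opprK addrC rz_subr_ge0. Qed.

Lemma rz_scale_le a x y : 0 <= a -> x <= y -> a *: x <= a *: y.
Proof. by move=> a0 xy; rewrite -rz_subr_ge0 -scalerBr riesz_scale_ge0// rz_subr_ge0. Qed.

Lemma rz_scale_leV a x y : 0 < a -> (a^-1 *: x <= y) = (x <= a *: y).
Proof.
move=> a0; apply/idP/idP => [/(rz_scale_le (ltW a0))|].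
  by rewrite scalerA divff ?scale1r// gt_eqF.
move=> /(@rz_scale_le a^-1); rewrite scalerA mulVf ?scale1r ?gt_eqF//; apply.
by rewrite invr_ge0 ltW.
Qed.

Lemma riesz_neg_ge0 x : 0 <= riesz_neg x. Proof. exact: rz_leUr. Qed.
Lemma riesz_neg_geN x : - x <= riesz_neg x. Proof. exact: rz_leUl. Qed.

Lemma riesz_abs_id x : 0 <= x -> riesz_abs x = x.
Proof.
move=> x0; apply/le_anti; rewrite rz_leUl riesz_leUx lexx/= andbT.
by rewrite (le_trans _ x0)// rz_oppr_le0.
Qed.

End RieszTheory.

Section Unitization.
Context {R : realType} {E : truncRieszType R}.
Implicit Types (x y e u : E) (a b l : R) (p q r : unitization E).

Lemma trunc_idem x : 0 <= x -> trunc (trunc x) = trunc x.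
Proof.
move=> x0; have t0 := trunc_ge0 x x0.
apply/le_anti; rewrite trunc_le//=.
by apply: le_trans (trunc_meet_le _ _ t0 x0); rewrite rz_meetxx.
Qed.

Lemma trunc_fix_ge x e : 0 <= x -> 0 <= e -> trunc e = e -> e <= x -> e <= trunc x.
Proof.
move=> x0 e0 te ex; apply: le_trans (trunc_meet_le _ _ x0 e0).
by rewrite te riesz_lexI ex lexx.
Qed.

Lemma trunc_fix_le x e : 0 <= x -> 0 <= e -> trunc e = e -> x <= e -> trunc x = x.
Proof.
move=> x0 e0 te xe; apply/le_anti; rewrite trunc_le//=.
by apply: le_trans (trunc_meet_le _ _ x0 e0); rewrite te riesz_lexI xe lexx.
Qed.

Lemma trunc_fixU x y : 0 <= x -> 0 <= y -> trunc x = x -> trunc y = y ->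
  trunc (riesz_join x y) = riesz_join x y.
Proof.
move=> x0 y0 tx ty; have xy0 : 0 <= riesz_join x y by rewrite rz_lexU.
apply/le_anti; rewrite trunc_le//= riesz_leUx.
by rewrite !trunc_fix_ge// ?rz_leUl ?rz_leUr.
Qed.

Lemma trunc_scale_ge u e l : 0 <= u -> 0 <= e -> trunc e = e -> 0 <= l ->
  riesz_meet u (l *: e) <= l *: trunc (l^-1 *: u).
Proof.
move=> u0 e0 te; rewrite le_eqVlt => /predU1P[<-|l0].
  by rewrite !scale0r rz_leIr.
have Vl : 0 <= l^-1 by rewrite invr_ge0 ltW.
rewrite -rz_scale_leV//.
apply: le_trans (trunc_meet_le _ e _ e0); last exact: riesz_scale_ge0.
by rewrite te riesz_lexI (rz_scale_le Vl (rz_leIl _ _))//= rz_scale_leV// rz_leIr.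
Qed.

Lemma trunc_scale_le u l : 0 <= u -> 0 <= l -> l *: trunc (l^-1 *: u) <= u.
Proof.
move=> u0; rewrite le_eqVlt => /predU1P[<-|l0]; first by rewrite scale0r.
have Vl : 0 <= l^-1 by rewrite invr_ge0 ltW.
have := rz_scale_le (ltW l0) (trunc_le _ (riesz_scale_ge0 _ _ Vl u0)).
by rewrite scalerA divff ?gt_eqF// scale1r.
Qed.

Lemma unit_coneP p : unit_cone p <->
  0 <= p.2 /\ exists e, [/\ 0 <= e, trunc e = e & - p.1 <= p.2 *: e].
Proof.
case: p => x l /=; split.
  case=> [[y /= y0 [<- <-]]|[/= l0 fx]].
    split=> //; exists (trunc 0); split; first exact: trunc_ge0.
      exact: trunc_idem.
    by rewrite scale0r rz_oppr_le0.
  have n0 : 0 <= l^-1 *: riesz_neg x.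
    by rewrite riesz_scale_ge0 ?riesz_neg_ge0// invr_ge0 ltW.
  split; first exact: ltW.
  exists (l^-1 *: riesz_neg x); split=> //; first by move: fx; rewrite /fixed_points/= riesz_abs_id.
  by rewrite scalerA divff ?gt_eqF// scale1r riesz_neg_geN.
case; rewrite le_eqVlt => /predU1P[<-|l0] [e [e0 te]].
  by rewrite scale0r rz_oppr_le0 => x0; left; exists x.
move=> xe; right; split=> //=.
have n0 : 0 <= l^-1 *: riesz_neg x.
  by rewrite riesz_scale_ge0 ?riesz_neg_ge0// invr_ge0 ltW.
rewrite /fixed_points/= riesz_abs_id//; apply: (trunc_fix_le n0 e0 te).
by rewrite rz_scale_leV// riesz_leUx xe/= riesz_scale_ge0// ltW.
Qed.

Lemma unit_cone_ge0 x : 0 <= x -> unit_cone (unit_in x).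
Proof. by left; exists x. Qed.

Lemma unit_coneD p q : unit_cone p -> unit_cone q -> unit_cone (p + q).
Proof.
move=> /unit_coneP[p0 [e [e0 te pe]]] /unit_coneP[q0 [f [f0 tf qf]]].
apply/unit_coneP; split; first by rewrite addr_ge0.
exists (riesz_join e f); split; first by rewrite rz_lexU.
  exact: trunc_fixU.
rewrite /= opprD scalerDl; apply: rz_leD.
  by apply: (le_trans pe); rewrite rz_scale_le// rz_leUl.
by apply: (le_trans qf); rewrite rz_scale_le// rz_leUr.
Qed.

Lemma unit_coneZ a p : 0 <= a -> unit_cone p -> unit_cone (a *: p).
Proof.
move=> a0 /unit_coneP[p0 [e [e0 te pe]]].
apply/unit_coneP; split; first by rewrite /= mulr_ge0.
exists e; split=> //=; rewrite -scalerN -scalerA.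
exact: rz_scale_le.
Qed.

Fact unit_le_refl : reflexive (@unit_le R E).
Proof. by move=> p; apply/asboolP; rewrite subrr; exact: unit_cone_ge0. Qed.

Fact unit_le_anti : antisymmetric (@unit_le R E).
Proof.
move=> [x a] [y b] /andP[/asboolP/unit_coneP[/= + [e [_ _ +]]]].
move=> + + /asboolP/unit_coneP[/= + [f [_ _ +]]].
rewrite !subr_ge0 => ab + ba.
have -> : a = b by apply/le_anti; rewrite ab ba.
rewrite subrr !scale0r !rz_oppr_le0 !rz_subr_ge0 => xy yx.
by congr pair; apply/le_anti; rewrite xy yx.
Qed.

Fact unit_le_trans : transitive (@unit_le R E).
Proof.
move=> q p r /asboolP pq /asboolP qr; apply/asboolP.
by rewrite -(subrKA q); exact: unit_coneD.
Qed.

HB.instance Definition _ := Order.Le_isPOrder.Build ring_display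
  (unitization E) unit_le_refl unit_le_anti unit_le_trans.

Lemma unit_leE p q : (p <= q) = `[< unit_cone (q - p) >].
Proof. by []. Qed.

Lemma unit_leP p q : reflect (unit_cone (q - p)) (p <= q).
Proof. exact: asboolP. Qed.

Lemma unit_leD2r r p q : p <= q -> p + r <= q + r.
Proof. by move=> /unit_leP pq; apply/unit_leP; rewrite [p + r]addrC addrKA. Qed.

Lemma unit_leBl p q r : (p - r <= q) = (p <= q + r).
Proof.
apply/idP/idP => [/(unit_leD2r r)|/(unit_leD2r (- r))].
  by rewrite subrK.
by rewrite addrK.
Qed.

Lemma unit_leN2 p q : (- p <= - q) = (q <= p).
Proof. by rewrite !unit_leE opprK addrC. Qed.

(* For l >= 0, this is the positive part of x - l, i.e. x^+ - l (x^+ / l)^bar. *)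
Definition unit_pos_subr x l : unitization E :=
  unit_in (riesz_join x 0 - l *: trunc (l^-1 *: riesz_join x 0)).

Definition unit_pos p : unitization E :=
  if p.2 <= 0 then unit_pos_subr p.1 (- p.2)
  else p + unit_pos_subr (- p.1) p.2.

Definition unit_join p q : unitization E := q + unit_pos (p - q).
Definition unit_meet p q : unitization E := - unit_join (- p) (- q).

Lemma unit_pos_subrP x l q : 0 <= l ->
  (unit_pos_subr x l <= q) = (0 <= q) && (((x, - l) : unitization E) <= q).
Proof.
move=> l0; rewrite /unit_pos_subr.
set u := riesz_join x 0; set b := trunc _.
have u0 : 0 <= u by rewrite rz_leUr.
have Vlu0 : 0 <= l^-1 *: u by rewrite riesz_scale_ge0// invr_ge0.
have b0 : 0 <= b by exact: trunc_ge0.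
have tb : trunc b = b by exact: trunc_idem.
have P0 : 0 <= unit_in (u - l *: b).
  apply/unit_leP; rewrite subr0; apply: unit_cone_ge0.
  by rewrite rz_subr_ge0 trunc_scale_le.
have Px : ((x, - l) : unitization E) <= unit_in (u - l *: b).
  apply/unit_leP/unit_coneP; split; first by rewrite /= opprK add0r.
  exists b; split=> //=; rewrite opprK add0r opprB.
  by rewrite rz_leBl addrC subrK rz_leUl.
apply/idP/andP => [Pq|[/unit_leP/unit_coneP + /unit_leP/unit_coneP]].
  by split; apply: le_trans Pq.
case: q => w m /=; rewrite !subr0 opprK => -[m0 [e1 [e10 te1 we1]]].
move=> [ml0 [e2 [e20 te2 we2]]].
apply/unit_leP/unit_coneP; split; first by rewrite /= subr0.
pose e := riesz_join e1 e2.
have e0 : 0 <= e by rewrite rz_lexU.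
have te : trunc e = e by exact: trunc_fixU.
exists e; split=> //=; rewrite subr0.
have ub := trunc_scale_ge u0 e0 te l0.
have we : - w <= m *: e by apply: (le_trans we1); rewrite rz_scale_le ?rz_leUl.
have xwe : x - w <= (m + l) *: e.
  by rewrite -opprB; apply: (le_trans we2); rewrite rz_scale_le ?rz_leUr.
have uwe : u - w <= (m + l) *: e.
  rewrite rz_leBl riesz_leUx -!rz_leBl xwe/= sub0r (le_trans we)//.
  by rewrite scalerDl -[leLHS]addr0 rz_leD ?riesz_scale_ge0.
have : u - w - m *: e <= riesz_meet u (l *: e).
  rewrite riesz_lexI; apply/andP; split.
    by rewrite rz_leBl rz_leD.
  by rewrite rz_leBl -scalerDl [l + m]addrC.
move=> /le_trans/(_ ub); rewrite rz_leBl [_ + m *: e]addrC -rz_leBl.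
by rewrite opprB addrAC.
Qed.

Lemma unit_posP p q : (unit_pos p <= q) = (0 <= q) && (p <= q).
Proof.
rewrite /unit_pos; case: ifPn => [p0|].
  by rewrite unit_pos_subrP ?oppr_ge0// opprK -surjective_pairing.
rewrite -ltNge => p0.
have -> : (p + unit_pos_subr (- p.1) p.2 <= q) =
    (unit_pos_subr (- p.1) p.2 <= q - p) by rewrite -unit_leBl opprK addrC.
rewrite unit_pos_subrP; last exact: ltW.
rewrite -[(- p.1, - p.2)]/(- p).
by rewrite -!unit_leBl opprK add0r addNr andbC.
Qed.

Lemma unit_leUx p q r : (unit_join p q <= r) = (p <= r) && (q <= r).
Proof.
rewrite /unit_join.
have -> : (q + unit_pos (p - q) <= r) = (unit_pos (p - q) <= r - q).
  by rewrite -unit_leBl opprK addrC.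
by rewrite unit_posP -!unit_leBl opprK add0r subrK andbC.
Qed.

Lemma unit_lexI p q r : (p <= unit_meet q r) = (p <= q) && (p <= r).
Proof. by rewrite -unit_leN2 opprK unit_leUx !unit_leN2. Qed.

Lemma unit_scale_ge0 a p : 0 <= a -> 0 <= p -> 0 <= a *: p.
Proof.
move=> a0 /unit_leP; rewrite subr0 => p0.
by apply/unit_leP; rewrite subr0; exact: unit_coneZ.
Qed.

HB.instance Definition _ := POrderedZmodule_isRiesz.Build R (unitization E)
  unit_leUx unit_lexI unit_leD2r unit_scale_ge0.

Lemma unit_in_le x y : (unit_in x <= unit_in y) = (x <= y).
Proof.
apply/unit_leP/idP => [/unit_coneP[_ [e [_ _ /=]]]|xy].
  by rewrite subrr scale0r rz_oppr_le0 rz_subr_ge0.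
apply/unit_coneP; split; first by rewrite /= subrr.
exists (trunc 0); split; [exact: trunc_ge0|exact: trunc_idem|].
by rewrite /= subrr scale0r rz_oppr_le0 rz_subr_ge0.
Qed.

Lemma unit_in_join x y :
  unit_in (riesz_join x y) = riesz_join (unit_in x) (unit_in y).
Proof.
apply/le_anti; rewrite [X in _ && X]riesz_leUx !unit_in_le rz_leUl rz_leUr !andbT.
set q := riesz_join (unit_in x) _.
have /unit_leP/unit_coneP : unit_in x <= q by exact: rz_leUl.
have /unit_leP/unit_coneP : unit_in y <= q by exact: rz_leUr.
case: q => w m /=; rewrite !subr0 => -[m0 [e [e0 te ye]]] [_ [f [f0 tf xf]]].
apply/unit_leP/unit_coneP; rewrite /= subr0; split=> //.
exists (riesz_join e f); split; [exact: rz_lexU|exact: trunc_fixU|].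
rewrite opprB rz_leBl riesz_leUx -!rz_leBl -opprB (le_trans xf) ?rz_scale_le ?rz_leUr//=.
by rewrite -opprB (le_trans ye) ?rz_scale_le ?rz_leUl.
Qed.

Lemma unit_in_trunc x : 0 <= x ->
  unit_in (trunc x) = riesz_meet (unit_in x) (unit_one E).
Proof.
move=> x0; have t0 := trunc_ge0 x x0.
apply/le_anti; rewrite riesz_lexI unit_in_le trunc_le//=; apply/andP; split.
  apply/unit_leP/unit_coneP; rewrite /= subr0; split=> //.
  by exists (trunc x); split; rewrite ?trunc_idem// scale1r sub0r opprK.
set q := riesz_meet _ _.
have /unit_leP/unit_coneP : q <= unit_in x by exact: rz_leIl.
have /unit_leP/unit_coneP : q <= unit_one E by exact: rz_leIr.
case: q => w m /=; rewrite sub0r opprK => -[m1 [e [e0 te we]]].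
rewrite !sub0r opprB => -[m0 [f [f0 tf wf]]].
apply/unit_leP/unit_coneP; rewrite /= sub0r; split=> //.
pose g := riesz_join e f.
have g0 : 0 <= g by exact: rz_lexU.
have tg : trunc g = g by exact: trunc_fixU.
exists g; split=> //; rewrite opprB rz_leBl addrC -rz_leBl scaleNr opprK.
apply: le_trans (trunc_meet_le _ _ x0 g0); rewrite tg riesz_lexI; apply/andP; split.
  rewrite -[_ *: g]opprK -scaleNr rz_leBl addrC -rz_leBl (le_trans wf)//.
  by rewrite rz_scale_le// rz_leUr.
rewrite -[_ *: g]opprK -scaleNr rz_leBl -[X in X + _]scale1r -scalerDl.
by rewrite (le_trans we)// rz_scale_le// rz_leUl.
Qed.

End Unitization.

(* Main.v *)
(* Let e be the supremum in E + R of the set of fixed points.  The map          *)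
(* P (x + l) = x + l e is positive and 1 - e >= 0, so p = P p + p.2 (1 - e)     *)
(* reduces suprema of sets B of positive elements to suprema of P B and of real *)
(* numbers.  Since l >= 0, x + l e is the supremum of the x + l a, a a fixed    *)
(* point, whence P B has the same upper bounds as a subset of E that is bounded *)
(* above by some y + m.  For a subset A of E with this bound, the elements      *)
(* m^-1 ((x \/ y) - y) are fixed points and the elements x /\ y are bounded by  *)
(* y, so the sets {x \/ y} and {x /\ y} have suprema, and so has A because      *)
(* x = x \/ y + x /\ y - y.                                                     *)

Require Import Defs.
From HB Require Import structures.
From mathcomp Require Import all_boot all_order all_algebra.
From mathcomp Require Import boolp classical_sets reals.

Local Open Scope classical_set_scope.
Local Open Scope ring_scope.

Import Order.TTheory GRing.Theory Num.Theory.

(** [E] is an order-convex sublattice of its unitization, so suprema of nonempty subsets of [E]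
    agree in both ([unit_in_supremums]). This yields completeness of [E] from that of the
    unitization; the property of fixed points is then a special case.

    Conversely, the splitting x = (x \/ y) + (x /\ y) - y gives suprema to all nonempty subsets of
    [E] bounded in the unitization ([supremums_unit_in]): fixed points control the joins,
    completeness of [E] the meets. With e the supremum of the fixed points, x + l = (x + l e) + l (1
    - e) then handles arbitrary sets: the first summand is approximated from within [E], the second
    is governed by a real supremum ([dedekind_complete_unitization]). *)

Lemma supremumsP d (T : porderType d) (A : set T) (s : T) :
  supremums A s <-> forall c, (s <= c)%O <-> ubound A c.
Proof.
split=> [[ubs lbs] c|sP].
  by split=> [sc x Ax|/lbs//]; apply: le_trans sc; exact: ubs.
by split=> [|c /sP//]; apply/sP.
Qed.

Section RieszSuprema.
Context {R : realType} {E : rieszType R}.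
Implicit Types (x y z c : E) (A : set E).

Lemma rz_leBr x y z : (x <= y - z) = (x + z <= y).
Proof. by rewrite -rz_leBl opprK. Qed.

Lemma rz_join_meetD x y : riesz_join x y + riesz_meet x y = x + y.
Proof.
apply/le_anti/andP; split.
  rewrite -rz_leBr riesz_leUx !rz_leBr rz_leD ?rz_leIr//=.
  by rewrite addrC rz_leD// rz_leIl.
rewrite [leRHS]addrC -rz_leBl riesz_lexI !rz_leBl rz_leD ?rz_leUr//=.
by rewrite addrC rz_leD// rz_leUl.
Qed.

Lemma rz_joinDr z x y : riesz_join x y + z = riesz_join (x + z) (y + z).
Proof.
apply/le_anti/andP; split; last by rewrite riesz_leUx !rz_leD ?rz_leUl ?rz_leUr.
by rewrite -rz_leBr riesz_leUx !rz_leBr rz_leUl rz_leUr.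
Qed.

Lemma rz_join_le2 x y z : x <= y -> riesz_join x z <= riesz_join y z.
Proof. by move=> xy; rewrite riesz_leUx rz_leUr (le_trans xy) ?rz_leUl. Qed.

Lemma rz_meet_le2 x y z : x <= y -> riesz_meet x z <= riesz_meet y z.
Proof. by move=> xy; rewrite riesz_lexI rz_leIr (le_trans _ xy) ?rz_leIl. Qed.

(** If c bounds A, then c \/ y and c /\ y bound the two families, and their sum is c + y; hence s +
    t - y is least. *)
Lemma supremums_join_meet A y :
  supremums [set riesz_join x y | x in A] !=set0 ->
  supremums [set riesz_meet x y | x in A] !=set0 ->
  supremums A !=set0.
Proof.
move=> [s [ubs lbs]] [t [ubt lbt]]; exists (s + t - y); split=> [x Ax|c ubc].
  rewrite rz_leBr -[x + y]rz_join_meetD; apply: rz_leD.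
    by apply: ubs; exists x.
  by apply: ubt; exists x.
rewrite rz_leBl -[c + y]rz_join_meetD; apply: rz_leD.
  by apply: lbs => _ [x Ax <-]; apply: rz_join_le2; exact: ubc.
by apply: lbt => _ [x Ax <-]; apply: rz_meet_le2; exact: ubc.
Qed.

(** For b in A, joining each element with b leaves the upper bounds of A unchanged, and translating
    by -b makes the set positive. *)
Lemma dedekind_complete_ge0 :
  (forall A, A !=set0 -> (forall x, A x -> 0 <= x) -> has_ubound A ->
    supremums A !=set0) ->
  dedekind_complete E.
Proof.
move=> supE A [b Ab] [M ubM].
have [|_ [x Ax <-]||s /supremumsP sP] := supE [set riesz_join x b - b | x in A].
- by exists (riesz_join b b - b), b.
- by rewrite rz_subr_ge0 rz_leUr.
- exists (M - b) => _ [x Ax <-].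
  by apply: rz_leD => //; rewrite riesz_leUx !ubM.
exists (s + b); apply/supremumsP => c.
rewrite -rz_leBr sP; split=> [ubc x Ax|ubc _ [x Ax <-]].
  apply: (le_trans (rz_leUl x b)); rewrite -[c](subrK b) -rz_leBl.
  by apply: ubc; exists x.
by rewrite rz_leD// riesz_leUx !ubc.
Qed.

End RieszSuprema.

Section UnitizationSuprema.
Context {R : realType} {E : truncRieszType R}.
Implicit Types (x y a : E) (p q c : unitization E) (A : set E).
Local Notation uin x := (unit_in x : unitization E).

Lemma unit_le_snd p q : p <= q -> p.2 <= q.2.
Proof. by move=> /unit_leP/unit_coneP[+ _]; rewrite subr_ge0. Qed.

Lemma unit_inD x y : uin (x + y) = uin x + uin y.
Proof. by congr pair; rewrite addr0. Qed.

Lemma unit_inN x : uin (- x) = - uin x.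
Proof. by congr pair; rewrite oppr0. Qed.

Lemma unit_in_meet x y : uin (riesz_meet x y) = riesz_meet (uin x) (uin y).
Proof.
apply: (addrI (riesz_join (uin x) (uin y))).
by rewrite rz_join_meetD -unit_in_join -!unit_inD rz_join_meetD.
Qed.

(** Convexity of [E]: the real coordinate is monotone, so here it is squeezed to 0. *)
Lemma unit_in_between x y p : uin x <= p -> p <= uin y -> exists z, p = uin z.
Proof.
move=> /unit_le_snd/= p0 /unit_le_snd/= p1; exists p.1.
by rewrite [LHS]surjective_pairing; congr pair; apply/le_anti; rewrite p0 p1.
Qed.

Lemma unit_in_supremums A s : A !=set0 ->
  supremums A s <-> supremums [set uin x | x in A] (uin s).
Proof.
move=> [x0 Ax0]; split=> [[ubs lbs]|[ubs lbs]].
  split=> [_ [x Ax <-]|c ubc]; first by rewrite unit_in_le; exact: ubs.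
  (* A bound c outside [E] is replaced by its meet with s, which lies between an element of A and s,
     hence in [E]. *)
  have ubm x : A x -> uin x <= riesz_meet c (uin s).
    by move=> Ax; rewrite riesz_lexI unit_in_le ubs// andbT; apply: ubc; exists x.
  have [z cz] := unit_in_between _ _ _ (ubm _ Ax0) (rz_leIr _ _).
  apply: le_trans (rz_leIl c (uin s)); rewrite cz unit_in_le.
  by apply: lbs => x /ubm; rewrite cz unit_in_le.
split=> [x Ax|c ubc]; first by rewrite -unit_in_le; apply: ubs; exists x.
by rewrite -unit_in_le; apply: lbs => _ [x Ax <-]; rewrite unit_in_le ubc.
Qed.

Lemma rz_abs_ge0 x : 0 <= riesz_abs x.
Proof.
have : 0 <= 2^-1 *: (riesz_abs x + riesz_abs x).
  rewrite riesz_scale_ge0 ?invr_ge0//; rewrite -(subrr x).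
  by apply: rz_leD; rewrite ?rz_leUl ?rz_leUr.
by rewrite -mulr2n -scaler_nat scalerA mulVf ?pnatr_eq0// scale1r.
Qed.

Lemma fixed_points_le x : fixed_points E x -> uin x <= unit_one E.
Proof.
move=> fx; apply/unit_leP/unit_coneP; rewrite /= subr0; split=> //.
by exists (riesz_abs x); rewrite sub0r opprK scale1r rz_leUl rz_abs_ge0.
Qed.

Lemma fixed_pointsN x : fixed_points E x -> fixed_points E (- x).
Proof. by rewrite /fixed_points/= /riesz_abs opprK rz_joinC. Qed.

Lemma fixed_points_ge0 x : 0 <= x -> fixed_points E x <-> trunc x = x.
Proof. by move=> x0; rewrite /fixed_points/= riesz_abs_id. Qed.

Lemma order_bounded_fixed_points A : A `<=` fixed_points E ->
  order_bounded [set uin x | x in A].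
Proof.
move=> Af; split; [exists (- unit_one E)|exists (unit_one E)] => _ [x /Af fx <-].
  by rewrite -rz_leN2 opprK -unit_inN; apply/fixed_points_le/fixed_pointsN.
exact: fixed_points_le.
Qed.

Lemma dedekind_complete_unit_in :
  dedekind_complete (unitization E) -> dedekind_complete E.
Proof.
move=> supF A [x0 Ax0] [u ubu].
have A0 : [set uin x | x in A] !=set0 by exists (uin x0), x0.
have ubA : ubound [set uin x | x in A] (uin u).
  by move=> _ [x Ax <-]; rewrite unit_in_le ubu.
have [s sup_s] := supF _ A0 (ex_intro _ _ ubA).
have [z sz] : exists z, s = uin z.
  apply: (unit_in_between x0 u); last by apply: sup_s.2.
  by apply: sup_s.1; exists x0.
exists z; apply/unit_in_supremums; first by exists x0.
by rewrite -sz.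
Qed.

Section Converse.
Hypothesis supE : dedekind_complete E.
Hypothesis supfix : forall A, A !=set0 -> A `<=` fixed_points E ->
  supremums [set uin x | x in A] !=set0.

Lemma supremums_unit_in A : A !=set0 -> has_ubound [set uin x | x in A] ->
  supremums [set uin x | x in A] !=set0.
Proof.
move=> [x0 Ax0] [[y l] ubA].
(* The bound y + l only forces l >= 0; adding 1 makes division possible. *)
pose m := l + 1.
have l0 : 0 <= l by have /unit_le_snd := ubA _ (ex_intro2 _ _ x0 Ax0 erefl).
have m0 : 0 < m by rewrite ltr_wpDl.
have mn0 : m != 0 by rewrite gt_eqF.
apply: (supremums_join_meet _ (uin y)).
  have [||t /supremumsP tP] := supfix [set m^-1 *: riesz_join (x - y) 0 | x in A].
  - by exists (m^-1 *: riesz_join (x0 - y) 0), x0.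
  - move=> _ [x Ax <-].
    have p0 : 0 <= m^-1 *: riesz_join (x - y) 0.
      by rewrite riesz_scale_ge0 ?rz_leUr// invr_ge0 ltW.
    have /unit_leP/unit_coneP[/= _ [e [e0 te]]] := ubA _ (ex_intro2 _ _ x Ax erefl).
    rewrite opprB subr0 => xye.
    apply/fixed_points_ge0 => //; apply: (trunc_fix_le p0 e0 te).
    rewrite rz_scale_leV// riesz_leUx riesz_scale_ge0 ?(ltW m0)// andbT.
    apply: (le_trans xye); rewrite /m scalerDl scale1r -[leLHS]addr0.
    exact: rz_leD.
  exists (m *: t + uin y); apply/supremumsP => c.
  have joinE x : uin (m^-1 *: riesz_join (x - y) 0) =
      m^-1 *: (riesz_join (uin x) (uin y) - uin y).
    rewrite -unit_inN -unit_in_join -unit_inD rz_joinDr subrr.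
    by congr pair; rewrite scaler0.
  rewrite -rz_leBr.
  have -> : (m *: t <= c - uin y) = (t <= m^-1 *: (c - uin y)).
    by rewrite -[m]invrK rz_scale_leV ?invr_gt0// invrK.
  rewrite tP; split=> [ubc _ [_ [x Ax <-] <-]|ubc _ [_ [x Ax <-] <-]].
    have : m^-1 *: (riesz_join (uin x) (uin y) - uin y) <= m^-1 *: (c - uin y).
      by rewrite -joinE; apply: ubc; exists (m^-1 *: riesz_join (x - y) 0) => //; exists x.
    by rewrite rz_scale_leV// scalerA divff// scale1r rz_leBl subrK.
  rewrite joinE rz_scale_le ?invr_ge0 ?(ltW m0)// rz_leD//.
  by apply: ubc; exists (uin x) => //; exists x.
have [||s] := supE [set riesz_meet x y | x in A].
- by exists (riesz_meet x0 y), x0.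
- by exists y => _ [x Ax <-]; exact: rz_leIr.
rewrite unit_in_supremums; last by exists (riesz_meet x0 y), x0.
rewrite !image_comp => sup_s; exists (uin s).
by under eq_imagel => x _ do rewrite /= -unit_in_meet.
Qed.

Lemma dedekind_complete_unitization : dedekind_complete (unitization E).
Proof.
have f0 : fixed_points E 0.
  apply/fixed_points_ge0 => //; apply/le_anti.
  by rewrite trunc_le// trunc_ge0.
have [||e eP] := supfix (fixed_points E); [by exists 0|by []|].
have e1 : e <= unit_one E by apply: eP.2 => _ [x fx <-]; exact: fixed_points_le.
pose P p := uin p.1 + p.2 *: e.
have PE p : p = P p + p.2 *: (unit_one E - e).
  rewrite /P scalerBr addrA addrAC addrK [LHS]surjective_pairing.
  by congr pair; rewrite /= ?scaler0 ?addr0// add0r /GRing.scale/= mulr1.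
(* The order provides a fixed point a with p.1 - q.1 <= (q.2 - p.2) a, and a <= e. *)
have P_le p q : p <= q -> P p <= P q.
  move=> /unit_leP/unit_coneP[+ [a [a0 ta]]]; rewrite subr_ge0 opprB => pq2 pqa.
  rewrite -rz_subr_ge0 /P opprD addrACA -scalerBl -unit_inN -unit_inD.
  rewrite -[uin _]opprK -unit_inN opprB addrC rz_subr_ge0.
  apply: (@le_trans _ _ ((q.2 - p.2) *: uin a)).
    have -> : (q.2 - p.2) *: uin a = uin ((q.2 - p.2) *: a).
      by congr pair; rewrite /= scaler0.
    by rewrite unit_in_le.
  apply: rz_scale_le; first by rewrite subr_ge0.
  by apply: eP.1; exists a => //; exact/fixed_points_ge0.
apply: dedekind_complete_ge0 => B [b0 Bb0] B0 [M ubM].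
have d0 : 0 <= unit_one E - e by rewrite rz_subr_ge0.
have scale_d (k l : R) : k <= l -> k *: (unit_one E - e) <= l *: (unit_one E - e).
  by move=> kl; rewrite -rz_subr_ge0 -scalerBl riesz_scale_ge0 ?subr_ge0.
have B2 p : B p -> 0 <= p.2 by move=> /B0/unit_le_snd.
(* P p itself may lie outside [E]; replacing e by the fixed points below it gives a subset of
   [E]. *)
pose A := [set x | exists2 p, B p & exists2 a, fixed_points E a & x = p.1 + p.2 *: a].
have uinA p a : uin (p.1 + p.2 *: a) = uin p.1 + p.2 *: uin a.
  by congr pair; rewrite /= scaler0 addr0.
have A_le p q a : B p -> fixed_points E a -> p <= q -> uin (p.1 + p.2 *: a) <= P q.
  move=> Bp fa /P_le; apply: le_trans; rewrite uinA rz_leD// rz_scale_le ?B2//.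
  by apply: eP.1; exists a.
have [||s [ubs lbs]] := supremums_unit_in A.
- by exists (b0.1 + b0.2 *: 0), b0 => //; exists 0.
- exists (P M) => _ [_ [p Bp [a fa ->]] <-].
  by apply: A_le => //; exact: ubM.
have supB2 : has_sup [set p.2 | p in B].
  split; first by exists b0.2, b0.
  by exists M.2 => _ [p Bp <-]; apply/unit_le_snd/ubM.
exists (s + sup [set p.2 | p in B] *: (unit_one E - e)); split=> [p Bp|c ubc].
  rewrite [p in p <= _]PE; apply: rz_leD; last first.
    by apply: scale_d; apply: sup_upper_bound => //; exists p.
  have ub_pa a : fixed_points E a -> uin p.1 + p.2 *: uin a <= s.
    move=> fa; rewrite -uinA; apply: ubs.
    by exists (p.1 + p.2 *: a) => //; exists p => //; exists a.
  (* If p.2 = 0, the fixed point 0 suffices; otherwise dividing by p.2 turns the bounds into an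
     upper bound of all fixed points, hence of e. *)
  rewrite /P; have := B2 _ Bp; rewrite le_eqVlt => /predU1P[p20|p20].
    by have := ub_pa _ f0; rewrite -p20 !scale0r.
  rewrite addrC -rz_leBr -[p.2]invrK rz_scale_leV ?invr_gt0//.
  apply: eP.2 => _ [a fa <-].
  rewrite -rz_scale_leV ?invr_gt0// invrK rz_leBr addrC.
  exact: ub_pa.
rewrite [c]PE; apply: rz_leD.
  apply: lbs => _ [_ [p Bp [a fa ->]] <-].
  by apply: A_le => //; exact: ubc.
apply: scale_d; apply: ge_sup; first by exists b0.2, b0.
by move=> _ [p Bp <-]; apply/unit_le_snd/ubc.
Qed.

End Converse.
End UnitizationSuprema.

Theorem theorem5p5 (R : realType) (E : truncRieszType R) :
  dedekind_complete (unitization E) <->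
  dedekind_complete E /\
  (forall A : set E, A !=set0 -> A `<=` fixed_points E ->
     order_bounded [set (unit_in x : unitization E) | x in A] ->
     supremums [set (unit_in x : unitization E) | x in A] !=set0).
Proof.
split=> [supF|[supE supfix]].
  split; first exact: dedekind_complete_unit_in.
  move=> A [x Ax] _ [_ ubA]; apply: supF => //.
  by exists (unit_in x), x.
apply: dedekind_complete_unitization => // A A0 Af.
by apply: supfix => //; exact: order_bounded_fixed_points.
Qed.
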